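(* Suppose the hospitals' preferences satisfy CPI with respect to $P^0_{hp}\in\mathbb{L}(D\cup\{\emptyset\})$, where for every couple $\{f,m\}\in C$ the labels are such that $f\,P^0_{hp}\,m$. If $P^0_{hp}$ does not satisfy SCPI, then there exists an RVT extension of $P^0_{hp}$ — a preference profile in which the hospitals' preferences satisfy CPI with respect to $P^0_{hp}$ and every couple's preference satisfies RVT with respect to the individual preferences of its two members — at which no stable matching exists.
   Context: Standing model. Let $H$ be a finite set of hospitals with $|H|\ge 2$; each $h\in H$ has a capacity $\kappa_h\in\mathbb{N}$ with $\kappa_h\ge 2$. Write $\bar H=H\cup\{\emptyset\}$, where being assigned $\emptyset$ means being unmatched. The finite set of doctors is $D=F\cup M\cup S$ (pairwise disjoint), with $F=\{f_1,\dots,f_k\}$, $M=\{m_1,\dots,m_k\}$, $k\ge 1$; the set of couples is $C=\{\{f_1,m_1\},\dots,\{f_k,m_k\}\}$, and doctors in $S$ are called single doctors. Assume $|D|\ge 4$ and $\sum_{h\in H}\kappa_h=|D|$. A matching is a map $\mu$ assigning to each $h\in H$ a set $\mu(h)\subseteq D$ with $|\mu(h)|\le\kappa_h$ and to each doctor $d$ an element $\mu(d)\in\bar H$, such that $\mu(d)=h$ iff $d\in\mu(h)$; for a couple $c=\{f,m\}$ write $\mu(c)=(\mu(f),\mu(m))$. For a set $X$, $\mathbb{L}(X)$ is the set of strict linear orders (preferences) on $X$; for a preference $P$, $R$ denotes its reflexive version ($xRy$ iff $x=y$ or $xPy$), and $r_1(P)$ its top element. Each hospital $h$ has a preference $\tilde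 P_h\in\mathbb{L}(D\cup\{\emptyset\})$ over individual doctors with $d\,\tilde P_h\,\emptyset$ for all $d\in D$, and a preference $P_h$ over the feasible sets $\{D'\subseteq D:|D'|\le\kappa_h\}$ that is responsive with respect to $\tilde P_h$: (i) on singletons and $\emptyset$, $P_h$ agrees with $\tilde P_h$; (ii) for all $D'\subsetneq D$ and all $D_1,D_2\subseteq D\setminus D'$ with $|D'\cup D_1|\le\kappa_h$, $|D'\cup D_2|\le\kappa_h$: $(D'\cup D_1)\,P_h\,(D'\cup D_2)$ iff $D_1\,P_h\,D_2$. Each doctor $d\in D$ has a preference $P_d\in\mathbb{L}(\bar H)$ with $h\,P_d\,\emptyset$ for all $h\in H$. Each couple $c=\{f,m\}$ has a preference $P_c\in\mathbb{L}(\bar H^2)$, where the pair $(h,h')$ means $f$ is assigned $h$ and $m$ is assigned $h'$; every pair in $H^2$ is preferred under $P_c$ to every pair in $\bar H^2\setminus H^2$. A preference profile consists of such preferences for all doctors, all couples and all hospitals. Blocking and stability. At a matching $\mu$, hospital $h$ is interested in a set $D'\subseteq D$ if there is $D''\subseteq\mu(h)$ with $|(\mu(h)\setminus D'')\cup D'|\le\kappa_h$ and $((\mu(h)\setminus D'')\cup D')\,P_h\,\mu(h)$. A pair $(h,s)$ with $h\in H$, $s\in S$ blocks $\mu$ if $h\,P_s\,\mu(s)$ and $h$ is interested in $\{s\}$. For a couple $c=\{f,m\}$ and $h_f,h_m\in H$, $((h_f,h_m),c)$ blocks $\mu$ if $(h_f,h_m)\,P_c\,\mu(c)$ and: (i)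 if $h_f\ne h_m$, $\mu(f)\ne h_f$ and $\mu(m)\ne h_m$, then $h_f$ is interested in $\{f\}$ and $h_m$ is interested in $\{m\}$; (ii) if $h_f\ne h_m$ and, for $\{x,y\}=\{f,m\}$, $\mu(x)=h_x$ and $\mu(y)\neq h_y$, then $h_y$ is interested in $\{y\}$; (iii) if $h_f=h_m=h$, then $h$ is interested in $\{f,m\}$. A matching is stable if it is blocked by no such pair. Responsive couple preference: $P_c$ for $c=\{f,m\}$ is responsive w.r.t. $P_f,P_m$ if for all $h,h_1,h_2\in\bar H$: $(h,h_1)P_c(h,h_2)$ iff $h_1P_mh_2$, and $(h_1,h)P_c(h_2,h)$ iff $h_1P_fh_2$. RVT (responsiveness violated for togetherness): a couple preference $\bar P_c\in\mathbb{L}(\bar H^2)$ of $c=\{f,m\}$ satisfies RVT w.r.t. $P_f,P_m$ if there is a preference $P_c\in\mathbb{L}(\bar H^2)$ responsive w.r.t. $P_f,P_m$ such that (i) for all $h\in H$ and $(h_1,h_2)\in\bar H^2$, $(h,h)P_c(h_1,h_2)$ implies $(h,h)\bar P_c(h_1,h_2)$; (ii) for all $(h,h'),(h_1,h_2)\in\bar H^2$ with $h\ne h'$ and $h_1\ne h_2$, $(h,h')P_c(h_1,h_2)$ iff $(h,h')\bar P_c(h_1,h_2)$. CPI: the hospitals' preferences satisfy CPI (common preference over individual doctors) with respect to $P^0_{hp}\in\mathbb{L}(D\cup\{\emptyset\})$ if every $P_h$ is responsive with respect to $P^0_{hp}$ (i.e. $\tilde P_h=P^0_{hp}$ for all $h$).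 SCPI: $P^0_{hp}$ (with $f\,P^0_{hp}\,m$ for every couple) satisfies SCPI (strong CPI) if for every couple $\{f,m\}\in C$: (i) if $m$ is not the lowest-ranked doctor of $D$ under $P^0_{hp}$, then either $|\{d\in D: f\,P^0_{hp}\,d\,P^0_{hp}\,m\}|=0$ or $|\{d\in D: d\,P^0_{hp}\,m\}|<\kappa_h$ for all $h\in H$; (ii) if $m$ is the lowest-ranked doctor of $D$ under $P^0_{hp}$, then $|\{d\in D: f\,P^0_{hp}\,d\,P^0_{hp}\,m\}|\le 1$. *)

(* Defs.v *)
(* Hospitals: a finType H; the "unmatched" value is None : option H.
   Doctors: a finType D; the "empty" element of D ∪ {∅} is None : option D.
   Couples are indexed by 'I_k: couple i = {fdoc i, mdoc i}. *)
From mathcomp Require Import all_boot.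
Set Implicit Arguments.
Unset Strict Implicit.
Unset Printing Implicit Defensive.

Definition strict_order_on (T : Type) (A : T -> Prop) (P : rel T) : Prop :=
  [/\ (forall x, A x -> ~~ P x x),
      (forall x y z, A x -> A y -> A z -> P x y -> P y z -> P x z)
    & (forall x y, A x -> A y -> x <> y -> P x y \/ P y x)].

Definition strict_order (T : Type) (P : rel T) : Prop :=
  strict_order_on (fun _ => True) P.

Definition is_single (D : finType) (k : nat) (fdoc mdoc : 'I_k -> D) (d : D) : Prop :=
  (forall i, d <> fdoc i) /\ (forall i, d <> mdoc i).

Definition set_of_opt (D : finType) (x : option D) : {set D} :=
  if x is Some d then [set d] else set0.

Definition hosp_responsive (D : finType) (q : nat) (tP : rel (option D))
    (Ph : rel {set D}) : Prop :=
  (forall x y : option D, Ph (set_of_opt x) (set_of_opt y) = tP x y) /\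
  (forall D' D1 D2 : {set D}, D' \proper setT ->
     D1 \subset ~: D' -> D2 \subset ~: D' ->
     #|D' :|: D1| <= q -> #|D' :|: D2| <= q ->
     Ph (D' :|: D1) (D' :|: D2) = Ph D1 D2).

Definition hosp_pref (D : finType) (q : nat) (tP : rel (option D))
    (Ph : rel {set D}) : Prop :=
  strict_order_on (fun A : {set D} => #|A| <= q) Ph /\ hosp_responsive q tP Ph.

Definition doctor_pref (H : finType) (P : rel (option H)) : Prop :=
  strict_order P /\ (forall h, P (Some h) None).

Definition in_H2 (H : finType) (x : option H * option H) : bool :=
  (x.1 != None) && (x.2 != None).

Definition couple_pref (H : finType) (P : rel (option H * option H)) : Prop :=
  strict_order P /\ (forall x y, in_H2 x -> ~~ in_H2 y -> P x y).

Definition couple_responsive (H : finType) (Pf Pm : rel (option H))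
    (P : rel (option H * option H)) : Prop :=
  forall h h1 h2 : option H,
    (P (h, h1) (h, h2) = Pm h1 h2) /\ (P (h1, h) (h2, h) = Pf h1 h2).

Definition RVT (H : finType) (Pf Pm : rel (option H))
    (barP : rel (option H * option H)) : Prop :=
  exists P : rel (option H * option H),
    [/\ strict_order P, couple_responsive Pf Pm P,
        (forall (h : H) (x : option H * option H),
            P (Some h, Some h) x -> barP (Some h, Some h) x)
      & (forall x y : option H * option H, x.1 <> x.2 -> y.1 <> y.2 ->
            P x y = barP x y)].

(* a matching is given by the doctors' assignments mu : D -> option H;
   mu(h) is the set of doctors assigned to h *)
Definition assigned (H D : finType) (mu : D -> option H) (h : H) : {set D} :=
  [set d | mu d == Some h].

Definition is_matching (H D : finType) (kappa : H -> nat) (mu : D -> option H) : Prop :=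
  forall h, #|assigned mu h| <= kappa h.

Definition interested (H D : finType) (kappa : H -> nat) (Ph : H -> rel {set D})
    (mu : D -> option H) (h : H) (A : {set D}) : Prop :=
  exists D'' : {set D},
    [/\ D'' \subset assigned mu h,
        #|(assigned mu h :\: D'') :|: A| <= kappa h
      & Ph h ((assigned mu h :\: D'') :|: A) (assigned mu h)].

Definition single_blocks (H D : finType) (kappa : H -> nat) (Ph : H -> rel {set D})
    (Pd : D -> rel (option H)) (mu : D -> option H) (h : H) (s : D) : Prop :=
  Pd s (Some h) (mu s) /\ interested kappa Ph mu h [set s].

Definition couple_blocks (H D : finType) (kappa : H -> nat) (Ph : H -> rel {set D})
    (Pc : rel (option H * option H)) (f m : D) (mu : D -> option H) (hf hm : H) : Prop :=
  [/\ Pc (Some hf, Some hm) (mu f, mu m),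
      (hf <> hm -> mu f <> Some hf -> mu m <> Some hm ->
         interested kappa Ph mu hf [set f] /\ interested kappa Ph mu hm [set m]),
      (hf <> hm -> mu f = Some hf -> mu m <> Some hm -> interested kappa Ph mu hm [set m]),
      (hf <> hm -> mu m = Some hm -> mu f <> Some hf -> interested kappa Ph mu hf [set f])
    & (hf = hm -> interested kappa Ph mu hf [set f; m])].

Definition stable (H D : finType) (kappa : H -> nat) (k : nat) (fdoc mdoc : 'I_k -> D)
    (Pd : D -> rel (option H)) (Pc : 'I_k -> rel (option H * option H))
    (Ph : H -> rel {set D}) (mu : D -> option H) : Prop :=
  [/\ is_matching kappa mu,
      (forall (h : H) (s : D), is_single fdoc mdoc s -> ~ single_blocks kappa Ph Pd mu h s)
    & (forall (i : 'I_k) (hf hm : H), ~ couple_blocks kappa Ph (Pc i) (fdoc i) (mdoc i) mu hf hm)].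

Definition lowest_doctor (D : finType) (P0 : rel (option D)) (m : D) : Prop :=
  forall d : D, d <> m -> P0 (Some d) (Some m).

Definition between_docs (D : finType) (P0 : rel (option D)) (f m : D) : {set D} :=
  [set d | P0 (Some f) (Some d) && P0 (Some d) (Some m)].

Definition better_docs (D : finType) (P0 : rel (option D)) (m : D) : {set D} :=
  [set d | P0 (Some d) (Some m)].

Definition SCPI (H D : finType) (kappa : H -> nat) (k : nat) (fdoc mdoc : 'I_k -> D)
    (P0 : rel (option D)) : Prop :=
  forall i : 'I_k,
    (~ lowest_doctor P0 (mdoc i) ->
       #|between_docs P0 (fdoc i) (mdoc i)| = 0 \/
       (forall h : H, #|better_docs P0 (mdoc i)| < kappa h)) /\
    (lowest_doctor P0 (mdoc i) -> #|between_docs P0 (fdoc i) (mdoc i)| <= 1).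

(* Main.v *)
Require Import Defs.
From mathcomp Require Import all_boot zify.
Set Implicit Arguments.
Unset Strict Implicit.
Unset Printing Implicit Defensive.

(** All hospitals compare sets first by size and then by their worst doctors
    (lexicographically from the bottom).  The couple {f, m} violating SCPI ranks
    every pair (h, h) above all other pairs, with (h1, h1) on top; the other couples
    are responsive.  A set Y of kappa h1 - 1 doctors, all better than m, puts h1
    first, and everybody outside Y and the couple puts h1 last.  A stable matching
    fills all hospitals, and since Y and the couple do not all fit into h1, the
    couple cannot be together there.

    If m is not the lowest doctor and kappa h1 doctors are better than m, the
    hospital of the lowest doctor e would accept the couple and any doctor other
    than e (the partner of e, who could not gain by evicting e, is put into Y if
    better than m).  So the couple is together at some h <> h1, and h1, which would not
    take the couple in, contains only members of Y, too few to fill it.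

    If m is the lowest doctor and d1, d2 lie between f and m, everybody may replace
    m.  Put d1 in Y, and let d2 rank h2 first while the others outside Y rank h2 just
    above h1.  If m is at h1, so is Y, and f can join m by replacing d1.  Otherwise h1
    consists of Y and f, while m and d2 are at h2, where f can join m by replacing d2. *)

(** * Binary encoding of finite sets *)

Lemma sum_pow2_lt (T : finType) (r : T -> nat) (A : {set T}) (n : nat) :
  injective r -> \sum_(x in A | r x < n) 2 ^ r x < 2 ^ n.
Proof.
move=> r_inj; elim: n => [|n IHn].
  by rewrite big_pred0 // => x; rewrite ltn0 andbF.
rewrite (bigID (fun x => r x < n)) /= expnS mul2n -addnn -addSn.
apply: leq_add.
  apply: leq_ltn_trans IHn; rewrite leq_eqVlt; apply/orP; left; apply/eqP.
  by apply: eq_bigl => x; case: (x \in A) => //=; lia.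
rewrite (eq_bigl (fun x => (x \in A) && (r x == n))); last first.
  by move=> x; case: (x \in A) => //=; lia.
case: (pickP (fun x => (x \in A) && (r x == n))) => [x Hx|none].
  rewrite (bigD1 x) //= big_pred0; last first.
    move=> y; case: (eqVneq y x) => [->|/eqP nyx]; rewrite ?andbF ?andbT //.
    apply/negbTE/negP => /andP[_ /eqP ry]; apply: nyx; apply: r_inj.
    by rewrite ry; case/andP: Hx => _ /eqP ->.
  by case/andP: Hx => _ /eqP ->; rewrite addn0.
by rewrite big_pred0.
Qed.

(** At the element of largest rank where the sets differ, one sum gains a power of two that the
    other cannot make up with smaller ranks, by [sum_pow2_lt]. *)
Lemma sum_pow2_inj (T : finType) (r : T -> nat) :
  injective r -> injective (fun A : {set T} => \sum_(x in A) 2 ^ r x).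
Proof.
move=> r_inj A B /= eqAB; apply/eqP; apply: contraT => neqAB.
have [x0 Hx0] : exists x, (x \in A) != (x \in B).
  apply/existsP; apply: contraT; rewrite negb_exists => /forallP eqv.
  case/eqP: neqAB; apply/setP=> x; apply/eqP.
  by have := eqv x; rewrite negbK.
case: (@arg_maxnP T x0 (fun x => (x \in A) != (x \in B)) r Hx0) => x {x0 Hx0} Hx xmax.
wlog [xA xB] : A B eqAB neqAB Hx xmax / x \in A /\ x \notin B.
  move=> IH; case xA: (x \in A); case xB: (x \in B).
  - by rewrite xA xB in Hx.
  - by apply: (IH A B); rewrite ?xA ?xB.
  - apply: (IH B A); rewrite ?xA ?xB ?(eq_sym B) //.
    by move=> y Hy; apply: xmax; rewrite eq_sym.
  - by rewrite xA xB in Hx.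
have above : \sum_(y in A | r x < r y) 2 ^ r y = \sum_(y in B | r x < r y) 2 ^ r y.
  apply: eq_bigl => y; case lt_xy: (r x < r y); rewrite ?andbF ?andbT //.
  apply/eqP; apply: contraT => Hy; have := xmax y Hy; lia.
have ltB := @sum_pow2_lt T r B (r x) r_inj.
move: eqAB; rewrite (bigID (fun y => r x < r y)) /= above.
rewrite [in RHS](bigID (fun y => r x < r y)) /= => /addnI eqlow.
have leA : 2 ^ r x <= \sum_(y in A | ~~ (r x < r y)) 2 ^ r y.
  by rewrite (bigD1 x) /= ?xA ?ltnn ?leq_addr.
move: leA; rewrite eqlow (eq_bigl (fun y => (y \in B) && (r y < r x))).
  by rewrite leqNgt ltB.
move=> y; case yB: (y \in B) => //=; rewrite -leqNgt leq_eqVlt.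
case: eqVneq => //= /r_inj eyx; by rewrite -eyx yB in xB.
Qed.

(** * The hospitals' common preference over sets of doctors *)

Section HospitalPreference.

Variables (D : finType) (P0 : rel (option D)).
Hypothesis P0so : strict_order P0.

Definition doc_rank (d : D) : nat := #|better_docs P0 d|.

Lemma P0_irr x : P0 x x = false.
Proof. by case: P0so => irr _ _; apply/negbTE/irr. Qed.

Lemma P0_trans x y z : P0 x y -> P0 y z -> P0 x z.
Proof. by case: P0so => _ tr _; apply: tr. Qed.

Lemma P0_total x y : x != y -> P0 x y || P0 y x.
Proof. by case: P0so => _ _ tot /eqP /(tot x y I I) [] ->; rewrite ?orbT. Qed.

Lemma P0_asym x y : P0 x y -> P0 y x = false.
Proof. by move=> xy; apply/negP => /(P0_trans xy); rewrite P0_irr. Qed.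

Lemma ltn_doc_rank d e : (doc_rank d < doc_rank e) = P0 (Some d) (Some e).
Proof.
have mono x y : P0 (Some x) (Some y) -> doc_rank x < doc_rank y.
  move=> xy; apply: proper_card; apply/properP; split.
    by apply/subsetP => z; rewrite !inE => /P0_trans; apply.
  by exists x; rewrite inE // P0_irr.
apply/idP/idP; last exact: mono.
case: (eqVneq d e) => [->|neq]; first by rewrite ltnn.
have /P0_total/orP[//|/mono lt_ed] : Some d != Some e by [].
by lia.
Qed.

Lemma doc_rank_inj : injective doc_rank.
Proof.
move=> d e eqr; apply/eqP; apply: contraT => neq.
have /P0_total : Some d != Some e by [].
by rewrite -!ltn_doc_rank eqr ltnn.
Qed.

(** Worse doctors carry higher binary digits, so comparing these numbers compares sets
    lexicographically from the worst doctor. *)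
Definition badness (A : {set D}) : nat := \sum_(d in A) 2 ^ doc_rank d.

Definition set_pref : rel {set D} := fun A B =>
  (#|B| < #|A|) || (#|A| == #|B|) && (badness A < badness B).

Lemma badnessU (A B : {set D}) :
  B \subset ~: A -> badness (A :|: B) = badness A + badness B.
Proof.
rewrite -disjoints_subset disjoint_sym => dAB.
by rewrite /badness -bigU //; apply: eq_bigl => x; rewrite !inE.
Qed.

Lemma badness1 d : badness [set d] = 2 ^ doc_rank d.
Proof. by rewrite /badness big_set1. Qed.

Lemma cardUC (A B : {set D}) : B \subset ~: A -> #|A :|: B| = #|A| + #|B|.
Proof.
by rewrite -disjoints_subset disjoint_sym -leq_card_setU => /eqP.
Qed.

(** Size and [badness] are additive over disjoint unions, which gives responsiveness; totality comes
    from [sum_pow2_inj]. *)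
Lemma set_pref_hosp_pref (q : nat) :
  (forall d, P0 (Some d) None) -> hosp_pref q P0 set_pref.
Proof.
move=> P0None; rewrite /set_pref; split; [split|split].
- by move=> A _; rewrite !ltnn andbF.
- by move=> A B C _ _ _; lia.
- move=> A B _ _ neq.
  have : badness A <> badness B by move/(sum_pow2_inj doc_rank_inj).
  by lia.
- have bad0 : badness set0 = 0 by rewrite /badness big_set0.
  move=> [d|] [e|] /=; rewrite ?cards1 ?cards0 ?badness1 ?bad0 /=.
  + by rewrite ltn_exp2l // ltn_doc_rank.
  + by rewrite P0None.
  + by rewrite P0_asym.
  + by rewrite P0_irr.
- move=> D' D1 D2 _ s1 s2 _ _.
  by rewrite !cardUC // !badnessU // ltn_add2l eqn_add2l ltn_add2l.
Qed.

Lemma set_pref_exchange (A : {set D}) d y :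
  y \in A -> d \notin A -> P0 (Some d) (Some y) ->
  #|d |: A :\ y| = #|A| /\ set_pref (d |: A :\ y) A.
Proof.
move=> yA dA dy.
have dAy : d \notin A :\ y by rewrite inE negb_and dA orbT.
have ecard : #|d |: A :\ y| = #|A| by rewrite cardsU1 dAy [RHS](cardsD1 y) yA.
split=> //; rewrite /set_pref ecard eqxx /=; apply/orP; right.
rewrite badnessU; last by rewrite subsetC sub1set inE dAy.
rewrite badness1 /badness [in X in _ < X](big_setD1 y yA) /= ltn_add2r.
by rewrite ltn_exp2l // ltn_doc_rank.
Qed.

(* The worst doctor dominates [badness], so evicting x pays for f and m however
   good the second evicted doctor z is. *)
Lemma set_pref_exchange2 (A : {set D}) f m x z :
  x \in A -> z \in A -> x != z -> f \notin A -> m \notin A ->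
  P0 (Some f) (Some m) -> P0 (Some m) (Some x) ->
  #|(A :\: [set x; z]) :|: [set f; m]| = #|A| /\
  set_pref ((A :\: [set x; z]) :|: [set f; m]) A.
Proof.
move=> xA zA nxz fA mA fm mx.
have nfm : f != m by apply/eqP => e; rewrite e P0_irr in fm.
have sub : [set f; m] \subset ~: (A :\: [set x; z]).
  by rewrite subUset !sub1set !inE (negbTE fA) (negbTE mA) !andbF.
have sA : [set x; z] \subset A by rewrite subUset !sub1set xA zA.
have ecard : #|(A :\: [set x; z]) :|: [set f; m]| = #|A|.
  rewrite cardUC // cards2 nfm -(cardsID [set x; z] A) (setIidPr sA) cards2 nxz.
  exact: addnC.
split=> //; rewrite /set_pref ecard eqxx /=; apply/orP; right.
rewrite badnessU // -[in X in _ < X](setID A [set x; z]) [badness (A :&: _ :|: _)]badnessU; last first.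
  by apply/subsetP => t; rewrite !inE => /andP[/negbTE ->]; rewrite andbF.
rewrite (setIidPr sA) addnC ltn_add2r /badness !big_setU1 ?inE // !big_set1.
have := fm; have := mx; rewrite -!ltn_doc_rank => mx' fm'.
have lef : 2 ^ doc_rank f < 2 ^ doc_rank m by rewrite ltn_exp2l.
have lem : 2 ^ (doc_rank m).+1 <= 2 ^ doc_rank x by rewrite leq_exp2l.
rewrite (leq_trans _ (leq_addr _ _)) // (leq_trans _ lem) //.
by rewrite expnS mul2n -addnn ltn_add2r.
Qed.

End HospitalPreference.

(** * Orders given by numerical keys *)

Lemma ltn_lex (B a b c d : nat) : b < B -> d < B ->
  (a * B + b < c * B + d) = (a < c) || (a == c) && (b < d).
Proof.
move=> bB dB; case: (ltngtP a c) => [lt_ac|lt_ca|->] /=.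
- have := leq_mul2r B a.+1 c; rewrite lt_ac orbT mulSn; lia.
- have := leq_mul2r B c.+1 a; rewrite lt_ca orbT mulSn; lia.
- by rewrite ltn_add2l.
Qed.

Lemma lex_inj (B a b c d : nat) : b < B -> d < B ->
  a * B + b = c * B + d -> a = c /\ b = d.
Proof. by move=> bB dB e; have := ltn_lex a c bB dB; have := ltn_lex c a dB bB; lia. Qed.

Definition key_pref (T : Type) (key : T -> nat) : rel T :=
  fun x y => key x < key y.

Lemma key_pref_strict_order (T : Type) (key : T -> nat) :
  injective key -> strict_order (key_pref key).
Proof.
move=> key_inj; split; rewrite /key_pref.
- by move=> x _; rewrite ltnn.
- by move=> x y z _ _ _; apply: ltn_trans.
- by move=> x y _ _ neq; have : key x <> key y by [move/key_inj]; lia.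
Qed.

(** * Preferences of doctors and couples built from tiers *)

Section DoctorAndCouplePreferences.

Variable H : finType.

(* Tiers take the values 0, 1, 2 and the best tier is 0. *)
Definition tier_key (t : H -> nat) (x : option H) : nat :=
  if x is Some h then t h * #|H| + enum_rank h else 3 * #|H|.

Lemma tier_key_Some_None t h : t h <= 2 -> tier_key t (Some h) < tier_key t None.
Proof.
move=> th; rewrite /tier_key -[3 * _]addn0.
by rewrite ltn_lex // ?(leq_trans _ (ltn_ord (enum_rank h))) //; lia.
Qed.

Lemma tier_key_tier t h g : t h < t g -> tier_key t (Some h) < tier_key t (Some g).
Proof. by move=> lt; rewrite /tier_key ltn_lex // lt. Qed.

Lemma tier_key_bound t x : (forall h, t h <= 2) -> tier_key t x < (3 * #|H|).+1.
Proof. by case: x => [h|] // t2; have := @tier_key_Some_None t h (t2 h); rewrite /=; lia. Qed.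

Lemma tier_key_inj t : (forall h, t h <= 2) -> injective (tier_key t).
Proof.
move=> t2 [h|] [g|] // e.
- have [_ /ord_inj/enum_rank_inj -> //] :=
    lex_inj (ltn_ord (enum_rank h)) (ltn_ord (enum_rank g)) e.
- by have := @tier_key_Some_None t h (t2 h); rewrite e ltnn.
- by have := @tier_key_Some_None t g (t2 g); rewrite -e ltnn.
Qed.

Definition tier_pref (t : H -> nat) : rel (option H) := key_pref (tier_key t).

Lemma tier_pref_doctor_pref t : (forall h, t h <= 2) -> doctor_pref (tier_pref t).
Proof.
move=> t2; split; first exact/key_pref_strict_order/tier_key_inj.
by move=> h; apply: tier_key_Some_None.
Qed.

Variables tf tm : H -> nat.
Hypotheses (tf2 : forall h, tf h <= 2) (tm2 : forall h, tm h <= 2).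

Let B := (3 * #|H|).+1.

(** Three digits in base [B]: the leading one sends pairs outside $H^2$ to the end, then f decides
    before m. *)
Definition couple_key (x : option H * option H) : nat :=
  (~~ in_H2 x * B + tier_key tf x.1) * B + tier_key tm x.2.

Definition couple_lex_pref : rel (option H * option H) := key_pref couple_key.

Lemma ltn_couple_key x y : couple_lex_pref x y =
  (in_H2 y < in_H2 x) || (in_H2 x == in_H2 y) &&
  ((tier_key tf x.1 < tier_key tf y.1) ||
   (tier_key tf x.1 == tier_key tf y.1) && (tier_key tm x.2 < tier_key tm y.2)).
Proof.
have fx := tier_key_bound x.1 tf2; have fy := tier_key_bound y.1 tf2.
have mx := tier_key_bound x.2 tm2; have my := tier_key_bound y.2 tm2.
rewrite /couple_lex_pref /key_pref /couple_key !ltn_lex //.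
case e: (_ * B + _ == _ * B + _).
  have [] := lex_inj fx fy (eqP e) => en ->.
  rewrite ltnn eqxx /=; move: en; by case: in_H2; case: in_H2.
case e2: (tier_key tf x.1 == tier_key tf y.1); last first.
  by case: in_H2; case: in_H2; rewrite /= ?orbF.
rewrite (eqP e2) in e *; rewrite ltnn /=.
by move: e; case: in_H2; case: in_H2; rewrite /= ?eqxx.
Qed.

Lemma couple_key_inj : injective couple_key.
Proof.
move=> x y e.
have [e1 /(tier_key_inj tm2) e2] :=
  lex_inj (tier_key_bound x.2 tm2) (tier_key_bound y.2 tm2) e.
have [_ /(tier_key_inj tf2) e3] :=
  lex_inj (tier_key_bound x.1 tf2) (tier_key_bound y.1 tf2) e1.
by case: x y e2 e3 {e e1} => [a b] [c d] /= -> ->.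
Qed.

Lemma couple_lex_strict_order : strict_order couple_lex_pref.
Proof. exact/key_pref_strict_order/couple_key_inj. Qed.

Lemma couple_lex_couple_pref : couple_pref couple_lex_pref.
Proof.
split; first exact: couple_lex_strict_order.
by move=> x y xin yin; rewrite ltn_couple_key xin (negbTE yin).
Qed.

(** With one coordinate fixed, the leading digits differ only if exactly one varying entry is
    [None], which the doctor ranks last anyway. *)
Lemma couple_lex_responsive :
  couple_responsive (tier_pref tf) (tier_pref tm) couple_lex_pref.
Proof.
have noSf h : (tier_key tf None < tier_key tf (Some h)) = false.
  by have := tier_key_Some_None (tf2 h); lia.
have noSm h : (tier_key tm None < tier_key tm (Some h)) = false.
  by have := tier_key_Some_None (tm2 h); lia.
move=> h h1 h2; rewrite !ltn_couple_key /in_H2 /tier_pref /key_pref /= !eqxx !ltnn.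
by split; case: h => [h|]; case: h1 => [h1|]; case: h2 => [h2|];
  rewrite ?tier_key_Some_None ?noSf ?noSm ?ltnn ?eqxx //= ?orbF ?andbF ?orbF.
Qed.

Lemma couple_lex_RVT : RVT (tier_pref tf) (tier_pref tm) couple_lex_pref.
Proof.
exists couple_lex_pref; split=> //; first exact: couple_lex_strict_order.
exact: couple_lex_responsive.
Qed.

Definition together (x : option H * option H) : bool :=
  (x.1 == x.2) && (x.1 != None).

(** Moving the pairs (h, h) to the front of a responsive order, with all other comparisons kept, is
    just what RVT allows. *)
Definition together_pref : rel (option H * option H) := fun x y =>
  (together y < together x) || (together x == together y) && couple_lex_pref x y.

Lemma together_couple_pref : couple_pref together_pref.
Proof.
have [[irr tr tot] H2] := couple_lex_couple_pref.
rewrite /together_pref; split; first split.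
- by move=> x _; rewrite (negbTE (irr x I)) ltnn andbF.
- move=> x y z _ _ _; have := tr x y z I I I.
  by case: (together x); case: (together y); case: (together z) => //= t /t.
- move=> x y _ _ /(tot x y I I).
  by case: (together x); case: (together y) => //=; [left|right].
- move=> x y xin yin; rewrite H2 //.
  have -> : together y = false; last by case: together.
  by move: yin; rewrite /in_H2 /together; case: y => [[?|] [?|]].
Qed.

Lemma together_RVT : RVT (tier_pref tf) (tier_pref tm) together_pref.
Proof.
exists couple_lex_pref; split.
- exact: couple_lex_strict_order.
- exact: couple_lex_responsive.
- move=> h x P; rewrite /together_pref P.
  have -> : together (Some h, Some h) by rewrite /together eqxx.
  by case: together.
- move=> x y /eqP/negbTE nx /eqP/negbTE ny.
  by rewrite /together_pref /together nx ny.
Qed.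

Lemma together_pref_apart h x :
  ~~ together x -> together_pref (Some h, Some h) x.
Proof. by move=> nx; rewrite /together_pref (negbTE nx) /together eqxx. Qed.

(** Among the pairs (h, h) the first digit that can differ is f's, so f's favourite hospital
    decides. *)
Lemma together_pref_top h1 x :
  (forall h, h != h1 -> tf h1 < tf h) -> x != (Some h1, Some h1) ->
  together_pref (Some h1, Some h1) x.
Proof.
move=> top neq; case tx: (together x); last by rewrite together_pref_apart ?tx.
case: x neq tx => [[g|] [g'|]] //; rewrite /together /= andbT => neq /eqP[e].
rewrite -{}e in neq *; have ngh : g != h1 by apply: contraNneq neq => ->.
rewrite /together_pref /together !eqxx /= ltn_couple_key /=.
by rewrite tier_key_tier // top.
Qed.

End DoctorAndCouplePreferences.

(** * Consequences of stability in a tiered profile *)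

Section Stability.

Variables (H D : finType) (kappa : H -> nat) (k : nat).
Variables (fdoc mdoc : 'I_k -> D) (P0 : rel (option D)).
Hypothesis kappa2 : forall h, 2 <= kappa h.
Hypothesis mdoc_inj : injective mdoc.
Hypothesis kappa_sum : \sum_(h : H) kappa h = #|D|.
Hypothesis P0so : strict_order P0.
Hypothesis P0fm : forall j, P0 (Some (fdoc j)) (Some (mdoc j)).

Variables (t : D -> H -> nat) (i : 'I_k).
Hypothesis t2 : forall d h, t d h <= 2.

Definition tiered_Pd (d : D) := tier_pref (t d).

Definition tiered_Pc (j : 'I_k) :=
  if j == i then together_pref (t (fdoc j)) (t (mdoc j))
  else couple_lex_pref (t (fdoc j)) (t (mdoc j)).

Definition common_Ph (h : H) := set_pref P0.

Lemma tiered_doctor_pref d : doctor_pref (tiered_Pd d).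
Proof. exact: tier_pref_doctor_pref. Qed.

Lemma tiered_couple_pref j : couple_pref (tiered_Pc j).
Proof.
rewrite /tiered_Pc; case: (j == i).
- exact: together_couple_pref.
- exact: couple_lex_couple_pref.
Qed.

Lemma tiered_RVT j : RVT (tiered_Pd (fdoc j)) (tiered_Pd (mdoc j)) (tiered_Pc j).
Proof.
rewrite /tiered_Pc; case: (j == i).
- exact: together_RVT.
- exact: couple_lex_RVT.
Qed.

Variable mu : D -> option H.
Hypothesis mu_stable : stable kappa fdoc mdoc tiered_Pd tiered_Pc common_Ph mu.

Let interested_in := interested kappa common_Ph mu.

Lemma assigned_le h : #|assigned mu h| <= kappa h.
Proof. by case: mu_stable. Qed.

Lemma fdoc_neq_mdoc j : fdoc j != mdoc j.
Proof. by apply/eqP => e; have := P0fm j; rewrite e P0_irr. Qed.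

Lemma not_interested_together j h :
  tiered_Pc j (Some h, Some h) (mu (fdoc j), mu (mdoc j)) ->
  ~ interested_in h [set fdoc j; mdoc j].
Proof. by move=> pref int; case: mu_stable => _ _ /(_ j h h) []; split. Qed.

Lemma interested_vacancy1 h d :
  #|assigned mu h| < kappa h -> mu d <> Some h -> interested_in h [set d].
Proof.
move=> vac nd; have dA : d \notin assigned mu h by rewrite inE; apply/eqP.
exists set0; rewrite sub0set setD0 setUC cardsU1 dA; split=> //.
by rewrite /common_Ph /set_pref cardsU1 dA ltnSn.
Qed.

(** If two newcomers meet a single free seat, any occupant z can be evicted: the size still grows by
    one, and size counts first. *)
Lemma interested_vacancy2 h f m :
  #|assigned mu h| < kappa h -> f != m -> (mu f, mu m) != (Some h, Some h) ->
  interested_in h [set f; m].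
Proof.
set A := assigned mu h => vac nfm nboth.
have lt : #|A| < #|A :|: [set f; m]|.
  apply: proper_card; rewrite properUl // subUset !sub1set !inE.
  by apply: contra nboth => /andP[/eqP -> /eqP ->].
case: (leqP #|A :|: [set f; m]| (kappa h)) => fits.
  by exists set0; rewrite sub0set setD0 /common_Ph /set_pref lt.
have le2 : #|A :|: [set f; m]| <= #|A| + 2.
  by rewrite (leq_trans (leq_card_setU _ _)) // cards2 nfm.
have [z zA] : exists z, z \in A.
  by apply/set0Pn; rewrite -card_gt0; have := kappa2 h; lia.
have disj : [disjoint A & [set f; m]].
  by rewrite -leq_card_setU cards2 nfm eqn_leq le2 /=; lia.
have disj' : [disjoint A :\ z & [set f; m]].
  by apply: disjointWl disj; apply: subD1set.
have ecard : #|(A :\ z) :|: [set f; m]| = #|A|.+1.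
  move: disj'; rewrite -leq_card_setU cards2 nfm => /eqP ->.
  by rewrite (cardsD1 z A) zA; lia.
exists [set z]; rewrite sub1set zA ecard /common_Ph /set_pref.
by rewrite ecard ltnSn vac.
Qed.

Lemma sum_assigned : \sum_h #|assigned mu h| = #|[pred d | mu d != None]|.
Proof.
transitivity (\sum_h \sum_d (mu d == Some h)).
  apply: eq_bigr => h _; rewrite -sum1_card big_mkcond /=.
  by apply: eq_bigr => d _; rewrite inE; case: eqP.
rewrite exchange_big -sum1_card [RHS]big_mkcond; apply: eq_bigr => d _ /=.
rewrite inE; case Ed: (mu d) => [g|] /=; last by rewrite big1.
rewrite (bigD1 g) //= eqxx big1 // => h nhg.
by rewrite (inj_eq Some_inj) eq_sym (negbTE nhg).
Qed.

(* A vacancy leaves some doctor unmatched, who then fills it, together with the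
   partner if there is one. *)
Lemma assigned_full h : #|assigned mu h| = kappa h.
Proof.
apply/eqP; rewrite eqn_leq assigned_le leqNgt; apply/negP => vac.
have [d /eqP Ed] : exists d, mu d == None.
  apply/existsP; apply: contraT; rewrite negb_exists => /forallP matched.
  have : \sum_g #|assigned mu g| < \sum_g kappa g.
    rewrite (bigD1 h) //= [X in _ < X](bigD1 h) //= -addSn leq_add //.
    by apply: leq_sum => g _; apply: assigned_le.
  rewrite kappa_sum sum_assigned ltnNge; case/negP; apply: subset_leq_card.
  by apply/subsetP => d _; rewrite inE matched.
have couple j : (mu (fdoc j) == None) || (mu (mdoc j) == None) -> False.
  move=> un; apply: (@not_interested_together j h).
    case: (tiered_couple_pref j) => _; apply=> //; rewrite /in_H2 /=.
    by rewrite -negb_or negbK.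
  apply: interested_vacancy2 => //; first exact: fdoc_neq_mdoc.
  by apply: contraTneq un => -[-> ->].
case: mu_stable => _ /(_ h d) single _; apply: single.
  by split=> j e; apply: (couple j); rewrite -e Ed ?orbT.
split; last by apply: interested_vacancy1; rewrite ?Ed.
by rewrite Ed; case: (tiered_doctor_pref d).
Qed.

Lemma mu_matched d : exists h, mu d = Some h.
Proof.
case Ed: (mu d) => [h|]; first by exists h.
have : \sum_g #|assigned mu g| < #|D|.
  rewrite sum_assigned -cardsT proper_card //; apply/properP; split.
    by apply/subsetP => x _; rewrite inE.
  by exists d; rewrite ?inE ?Ed.
by rewrite -kappa_sum (eq_bigr _ (fun h _ => assigned_full h)) ltnn.
Qed.

(** Everyone in X but d is already at h and stays, so admitting X amounts to replacing y by d. This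
    covers singletons and couples with one member at h. *)
Lemma interested_exchange h d y (X : {set D}) :
  mu y = Some h -> mu d <> Some h -> P0 (Some d) (Some y) ->
  d \in X -> X :\ d \subset assigned mu h :\ y -> interested_in h X.
Proof.
move=> Ey nd dy dX sX.
have yA : y \in assigned mu h by rewrite inE Ey.
have dA : d \notin assigned mu h by rewrite inE; apply/eqP.
have [ecard pref] := set_pref_exchange P0so yA dA dy.
have eX : (assigned mu h :\ y) :|: X = d |: assigned mu h :\ y.
  by rewrite -(setD1K dX) setUCA (setUidPl sX).
by exists [set y]; rewrite sub1set yA eX ecard assigned_le.
Qed.

(** If one of f and m is already at h, the other replaces x. Otherwise x leaves with a second
    occupant z, which exists because h is full and has at least two seats. *)
Lemma interested_dominated h f m x :
  mu x = Some h -> P0 (Some f) (Some m) -> P0 (Some m) (Some x) ->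
  (mu f, mu m) != (Some h, Some h) -> interested_in h [set f; m].
Proof.
move=> Ex fm mx nboth.
have fx := P0_trans P0so fm mx.
have nfm : f != m by apply/eqP => e; rewrite e P0_irr in fm.
have nfx : f != x by apply/eqP => e; rewrite e P0_irr in fx.
have nmx : m != x by apply/eqP => e; rewrite e P0_irr in mx.
have xA : x \in assigned mu h by rewrite inE Ex.
have [Ef|/eqP nf] := eqVneq (mu f) (Some h).
  have nm : mu m <> Some h by move=> Em; rewrite Ef Em eqxx in nboth.
  apply: (interested_exchange Ex nm mx); rewrite ?inE ?eqxx ?orbT //.
  apply/subsetP => z; rewrite !inE => /andP[/negbTE ->].
  by rewrite orbF => /eqP ->; rewrite nfx Ef eqxx.
have [Em|/eqP nm] := eqVneq (mu m) (Some h).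
  apply: (interested_exchange Ex nf fx); rewrite ?inE ?eqxx //.
  apply/subsetP => z; rewrite !inE => /andP[/negbTE ->].
  by rewrite orFb => /eqP ->; rewrite nmx Em eqxx.
have [z] : exists z, z \in assigned mu h :\ x.
  apply/set0Pn; rewrite -card_gt0; have := cardsD1 x (assigned mu h).
  by rewrite xA assigned_full; have := kappa2 h; lia.
rewrite in_setD1 => /andP[nzx zA].
have fA : f \notin assigned mu h by rewrite inE; apply/eqP.
have mA : m \notin assigned mu h by rewrite inE; apply/eqP.
have nxz : x != z by rewrite eq_sym.
have [ecard pref] := set_pref_exchange2 P0so xA zA nxz fA mA fm mx.
by exists [set x; z]; rewrite subUset !sub1set xA zA ecard assigned_le.
Qed.

(** Otherwise d, alone or with a partner who keeps the same hospital, blocks by replacing y. The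
    partner must not be y: this is assumed for d = [fdoc j], while for d = [mdoc j] the partner is
    better than d and y is worse. *)
Lemma no_envy d y g h :
  d <> fdoc i -> d <> mdoc i -> (forall j, d = fdoc j -> y <> mdoc j) ->
  mu d = Some g -> mu y = Some h -> P0 (Some d) (Some y) ->
  t d g <= t d h.
Proof.
move=> nf nm npart Ed Ey dy; rewrite leqNgt; apply/negP => lt.
have nd : mu d <> Some h.
  by rewrite Ed => -[e]; rewrite e ltnn in lt.
have better : tiered_Pd d (Some h) (mu d) by rewrite Ed; apply: tier_key_tier.
have int1 : interested_in h [set d].
  by apply: (interested_exchange Ey nd dy); rewrite ?inE // setDv sub0set.
(* If the partner p is already at h, blocking requires interest in the whole couple. *)
have int2 p : mu p = Some h -> p <> y -> interested_in h [set d; p].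
  move=> Ep npy; apply: (interested_exchange Ey nd dy); rewrite ?inE ?eqxx //.
  apply/subsetP => z; rewrite !inE => /andP[/negbTE ->] /= /eqP ->.
  by rewrite Ep eqxx andbT; apply/eqP.
case: mu_stable => _ single couple.
case: (pickP (fun j => fdoc j == d)) => [j /eqP Ej|nfd].
  have nji : j != i by apply: contra_not_neq nf => <-.
  have [hm Em] := mu_matched (mdoc j).
  apply: (couple j h hm); split.
  - rewrite Ej Em /tiered_Pc (negbTE nji).
    have [_ ->] := couple_lex_responsive (t2 (fdoc j)) (t2 (mdoc j)) (Some hm) (Some h) (mu d).
    by rewrite Ej.
  - by [].
  - by rewrite Ej.
  - by rewrite Ej.
  - move=> e; rewrite Ej; apply: int2; first by rewrite Em e.
    by move/esym; apply: npart.
case: (pickP (fun j => mdoc j == d)) => [j /eqP Ej|nmd].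
  have nji : j != i by apply: contra_not_neq nm => <-.
  have [hf Ef] := mu_matched (fdoc j).
  apply: (couple j hf h); split.
  - rewrite Ej Ef /tiered_Pc (negbTE nji).
    have [-> _] := couple_lex_responsive (t2 (fdoc j)) (t2 (mdoc j)) (Some hf) (Some h) (mu d).
    by rewrite Ej.
  - by [].
  - by rewrite Ej.
  - by rewrite Ej.
  - move=> e; rewrite Ej setUC e; apply: int2; first by rewrite Ef e.
    by move=> e'; have := P0fm j; rewrite Ej e' P0_asym.
apply: (single h d); last by split.
by split=> j e; [have := nfd j|have := nmd j]; rewrite e eqxx.
Qed.

(** * Contradictions for the couple violating SCPI *)

Let f := fdoc i.
Let m := mdoc i.

Variables (h1 : H) (Y : {set D}).
Hypothesis Ycard : #|Y|.+1 = kappa h1.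
Hypothesis fY : f \notin Y.
Hypothesis mY : m \notin Y.
Hypothesis top_f : forall h, h != h1 -> t f h1 < t f h.
Hypothesis top_Y : forall y h, y \in Y -> h != h1 -> t y h1 < t y h.
Hypothesis bottom_others : forall d h,
  d \notin Y -> d != f -> d != m -> h != h1 -> t d h < t d h1.

Lemma prefers_together_apart h :
  ~~ together (mu f, mu m) -> tiered_Pc i (Some h, Some h) (mu f, mu m).
Proof. by move=> apart; rewrite /tiered_Pc eqxx; apply: together_pref_apart. Qed.

Lemma prefers_together_top :
  (mu f, mu m) != (Some h1, Some h1) ->
  tiered_Pc i (Some h1, Some h1) (mu f, mu m).
Proof. by move=> neq; rewrite /tiered_Pc eqxx; apply: together_pref_top. Qed.

Lemma not_all_in_h1 :
  mu f = Some h1 -> mu m = Some h1 -> ~ (forall y, y \in Y -> mu y = Some h1).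
Proof.
move=> Ef Em EY.
have sub : f |: (m |: Y) \subset assigned mu h1.
  apply/subsetP => z; rewrite !inE.
  by case/or3P=> [/eqP ->|/eqP ->|/EY ->]; rewrite ?Ef ?Em.
have := subset_leq_card sub; rewrite assigned_full !cardsU1 !inE negb_or.
by rewrite fY mY fdoc_neq_mdoc /=; lia.
Qed.

(** A member of Y placed elsewhere would envy m; it is not m's partner, since f is outside Y. *)
Lemma Y_in_h1_of_m : (forall y, y \in Y -> P0 (Some y) (Some m)) ->
  mu m = Some h1 -> forall y, y \in Y -> mu y = Some h1.
Proof.
move=> Ym Em y yY; have [g Eg] := mu_matched y.
have [<- //|ng] := eqVneq g h1.
have : t y g <= t y h1; last by rewrite leqNgt top_Y.
apply: (no_envy _ _ _ Eg Em (Ym _ yY)).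
- by move=> e; move: fY; rewrite /f -e yY.
- by move=> e; move: mY; rewrite /m -e yY.
- by move=> j e /mdoc_inj eij; move: fY; rewrite /f eij -e yY.
Qed.

(* The hospital of the worst doctor e attracts the couple if it is apart, and
   every doctor of h1 outside Y. *)
Lemma not_stable_not_lowest e :
  P0 (Some m) (Some e) -> (forall d, d <> e -> P0 (Some d) (Some e)) ->
  (forall y, y \in Y -> P0 (Some y) (Some m)) ->
  (forall j, mdoc j = e -> P0 (Some (fdoc j)) (Some m) -> fdoc j \in Y) ->
  False.
Proof.
move=> me e_low Ym Ypart.
have [he Ee] := mu_matched e; have [h Eh] := mu_matched m.
have tog : together (mu f, mu m).
  apply: contraT => apart; case: (not_interested_together (prefers_together_apart he apart)).
  apply: (interested_dominated Ee) => //.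
  by apply: contraNneq apart => ->; rewrite /together eqxx.
have Ef : mu f = Some h by case/andP: tog => /= /eqP ->.
have nh : h != h1.
  apply/eqP => eh; rewrite {}eh in Eh Ef.
  exact: not_all_in_h1 Ef Eh (Y_in_h1_of_m Ym Eh).
have neq : (mu f, mu m) != (Some h1, Some h1).
  by rewrite Ef; apply: contra nh => /eqP[->].
have in_h1_better o : mu o = Some h1 -> P0 (Some o) (Some m).
  move=> Eo; have : Some o != Some m.
    by apply: contraNneq nh => -[eom]; rewrite -(inj_eq Some_inj) -Eh -eom Eo.
  case/(P0_total P0so)/orP=> // mo.
  case: (not_interested_together (prefers_together_top neq)).
  exact: (interested_dominated Eo).
have nhe : he != h1.
  apply/eqP => ehe; rewrite ehe in Ee.
  by have := in_h1_better _ Ee; rewrite P0_asym.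
(* An occupant o outside Y would prefer [he] to [h1] and could replace e. If e is o's partner,
   [Ypart] puts o in Y after all. *)
have sub : assigned mu h1 \subset Y.
  apply/subsetP => o; rewrite inE => /eqP Eo; apply: contraT => oY.
  have nof : o != f.
    by apply: contraNneq nh => eof; rewrite -(inj_eq Some_inj) -Ef -eof Eo.
  have nom : o != m.
    by apply: contraNneq nh => eom; rewrite -(inj_eq Some_inj) -Eh -eom Eo.
  have : t o h1 <= t o he; last by rewrite leqNgt bottom_others.
  apply: (no_envy _ _ _ Eo Ee); try exact/eqP.
  - move=> j eo /esym ej; move: oY; rewrite eo Ypart // -eo.
    exact: in_h1_better.
  - apply: e_low => eoe; rewrite eoe Ee in Eo.
    by case: Eo nhe => ->; rewrite eqxx.
by have := subset_leq_card sub; rewrite assigned_full -Ycard ltnn.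
Qed.

(* Everybody may replace m, so nobody envies the colleagues of m; this forces
   a colleague of m to be d1 or d2, whom f may replace. *)
Lemma not_stable_lowest h2 d1 d2 :
  (forall d, d <> m -> P0 (Some d) (Some m)) ->
  d1 \in Y -> d2 \notin Y -> d2 <> m ->
  P0 (Some f) (Some d1) -> P0 (Some f) (Some d2) ->
  h2 != h1 -> (forall h, h != h2 -> t d2 h2 < t d2 h) ->
  (forall d h, d \notin Y -> d != f -> d != m -> d != d2 ->
     h != h1 -> h != h2 -> t d h < t d h2) ->
  False.
Proof.
move=> m_low d1Y d2Y d2m fd1 fd2 nh21 top2 bottom2.
have nd2f : d2 != f by apply/eqP => e; rewrite e P0_irr in fd2.
have Ym y : y \in Y -> P0 (Some y) (Some m).
  by move=> yY; apply: m_low => e; rewrite e (negbTE mY) in yY.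
have [b Em] := mu_matched m.
have envy d g : d \notin Y -> d != f -> d != m -> mu d = Some g -> t d g <= t d b.
  move=> dY /eqP df /eqP dm Ed; apply: (no_envy _ _ _ Ed Em) => //.
    by move=> j ed /mdoc_inj eij; apply: df; rewrite ed -eij.
  exact: m_low.
have take_f h d : mu m = Some h -> mu f <> Some h -> mu d = Some h -> d <> m ->
    P0 (Some f) (Some d) -> interested_in h [set f; m].
  move=> Emh nfh Ed dm fd; apply: (interested_exchange Ed nfh fd).
    by rewrite !inE eqxx.
  apply/subsetP => z; rewrite !inE => /andP[/negbTE ->] /= /eqP ->.
  by rewrite Emh eqxx andbT; apply/eqP => e; apply: dm.
have [eb|nb] := eqVneq b h1.
  rewrite eb in Em; have Yh1 := Y_in_h1_of_m Ym Em.
  have nf : mu f <> Some h1 by move=> Ef; apply: not_all_in_h1 Ef Em Yh1.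
  apply: (@not_interested_together i h1).
    by apply: prefers_together_top; apply/eqP => -[].
  apply: (take_f h1 d1) => //; first exact: Yh1.
  by move=> e; rewrite e (negbTE mY) in d1Y.
(* Any further occupant of [h1] ranks it last and would envy m at b; equality follows by
   counting. *)
have eh1 : assigned mu h1 = f |: Y.
  apply/eqP; rewrite eqEcard cardsU1 fY add1n Ycard assigned_full leqnn andbT.
  apply/subsetP => o; rewrite !inE => /eqP Eo.
  apply: contraT; rewrite negb_or => /andP[nof oY].
  have nom : o != m.
    by apply: contraNneq nb => eom; rewrite -(inj_eq Some_inj) -Em -eom Eo.
  by have := envy o h1 oY nof nom Eo; rewrite leqNgt bottom_others.
have in_h1 o : (mu o == Some h1) = (o == f) || (o \in Y).
  by have /setP/(_ o) := eh1; rewrite !inE.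
have Ef : mu f = Some h1 by apply/eqP; rewrite in_h1 eqxx.
(* Otherwise [h2], having at least two seats, holds some z other than d2. As z is neither m nor in
   [f |: Y], it ranks [h2] just above [h1] and envies m at b. *)
have eb : b = h2.
  apply/eqP; apply: contraT => nb2.
  have [z] : exists z, z \in assigned mu h2 :\ d2.
    apply/set0Pn; rewrite -card_gt0; have := cardsD1 d2 (assigned mu h2).
    by rewrite assigned_full; have := kappa2 h2; case: (d2 \in _); lia.
  rewrite !inE => /andP[nz2 /eqP Ez].
  have := in_h1 z; rewrite Ez (inj_eq Some_inj) (negbTE nh21).
  move/esym/negbT; rewrite negb_or => /andP[nzf zY].
  have nzm : z != m.
    by apply: contraNneq nb2 => ezm; rewrite -(inj_eq Some_inj) -Em -ezm Ez.
  by have := envy z h2 zY nzf nzm Ez; rewrite leqNgt bottom2.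
rewrite {}eb in Em envy.
have [g Ed2] := mu_matched d2.
(* Since m is at d2's favourite hospital, d2 must be there too. *)
have eg : g = h2.
  apply/eqP; apply: contraT => ng.
  have := envy d2 g d2Y nd2f (introN eqP d2m) Ed2.
  by rewrite leqNgt top2.
rewrite {}eg in Ed2.
have nf2 : mu f <> Some h2.
  by rewrite Ef => -[e]; rewrite e eqxx in nh21.
apply: (@not_interested_together i h2).
  apply: prefers_together_apart; rewrite /together /= Ef Em (inj_eq Some_inj).
  by rewrite eq_sym (negbTE nh21).
exact: (take_f h2 d2).
Qed.

End Stability.

(** * From a violation of SCPI to the set Y and the tiers *)

Lemma exists_set_between (T : finType) (S U : {set T}) (n : nat) :
  S \subset U -> #|S| <= n <= #|U| ->
  exists Y : {set T}, [/\ S \subset Y, Y \subset U & #|Y| = n].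
Proof.
move=> sSU /andP[]; elim: n => [|n IHn].
  by rewrite leqn0 => /eqP S0 _; exists S.
rewrite leq_eqVlt => /predU1P[eSn _|ltSn ltnU]; first by exists S.
have [Y [sSY sYU cY]] := IHn ltSn (ltnW ltnU).
have [x] : exists x, x \in U :\: Y.
  by apply/set0Pn; rewrite -card_gt0 cardsDS // cY subn_gt0.
rewrite inE => /andP[xY xU]; exists (x |: Y); split.
- exact: subset_trans sSY (subsetUr _ _).
- by rewrite subUset sub1set xU.
- by rewrite cardsU1 xY cY.
Qed.

Lemma exists_lowest_doctor (D : finType) (P0 : rel (option D)) (m : D) :
  strict_order P0 -> exists e, lowest_doctor P0 e.
Proof.
move=> P0so; case: (@arg_maxnP D m xpredT (doc_rank P0) isT) => e _ emax.
exists e => d /eqP nde; have /(P0_total P0so)/orP[//|] : Some d != Some e by [].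
by rewrite -(ltn_doc_rank P0so) ltnNge; case/negP; apply: emax.
Qed.

(** X stands for Y together with the couple. Taking h2 = h1 and d2 in X switches off the special
    treatment of h2 and d2. *)
Definition tiers (H D : finType) (h1 h2 : H) (X : {set D}) (d2 d : D) (h : H) : nat :=
  if d \in X then nat_of_bool (h != h1)
  else if h == h1 then 2 else if d == d2 then h != h2 else h == h2.

Lemma tiers_le2 (H D : finType) (h1 h2 : H) (X : {set D}) (d2 d : D) (h : H) :
  tiers h1 h2 X d2 d h <= 2.
Proof. by rewrite /tiers; do ?case: ifP => // _; case: eqP. Qed.

(** Finiteness makes the violation decidable ([bad]), so a search over the couples produces the
    witness constructively. *)
Lemma not_SCPI_witness (H D : finType) (kappa : H -> nat) (k : nat)
    (fdoc mdoc : 'I_k -> D) (P0 : rel (option D)) :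
  ~ SCPI kappa fdoc mdoc P0 ->
  exists i,
    (~ lowest_doctor P0 (mdoc i) /\
     exists h, kappa h <= #|better_docs P0 (mdoc i)|) \/
    (lowest_doctor P0 (mdoc i) /\
     1 < #|between_docs P0 (fdoc i) (mdoc i)|).
Proof.
move=> nSCPI.
pose low d := [forall e, (e != d) ==> P0 (Some e) (Some d)].
have lowP d : reflect (lowest_doctor P0 d) (low d).
  apply: (iffP forallP) => [lowd e /eqP ned|lowd e]; first exact: (implyP (lowd e)).
  by apply/implyP => /eqP; apply: lowd.
pose bad i := if low (mdoc i) then 1 < #|between_docs P0 (fdoc i) (mdoc i)|
              else [exists h, kappa h <= #|better_docs P0 (mdoc i)|].
case: (pickP bad) => [i|good].
  rewrite /bad; case: (lowP (mdoc i)) => lowi bi; exists i; first by right.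
  by left; split=> //; apply/existsP.
case: nSCPI => i; have := good i; rewrite /bad; case: (lowP (mdoc i)) => lowi bi.
  by split=> // _; rewrite leqNgt bi.
split=> // _; right=> h; rewrite ltnNge; apply/negP => le.
by case/existsP: bi; exists h.
Qed.

Theorem theorem3 (H D : finType) (kappa : H -> nat) (k : nat)
    (fdoc mdoc : 'I_k -> D) (P0 : rel (option D)) :
  2 <= #|H| ->
  (forall h, 2 <= kappa h) ->
  1 <= k ->
  injective fdoc -> injective mdoc ->
  (forall i j, fdoc i <> mdoc j) ->
  4 <= #|D| ->
  \sum_(h : H) kappa h = #|D| ->
  strict_order P0 ->
  (forall d : D, P0 (Some d) None) ->
  (forall i : 'I_k, P0 (Some (fdoc i)) (Some (mdoc i))) ->
  ~ SCPI kappa fdoc mdoc P0 ->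
  exists (Pd : D -> rel (option H)) (Pc : 'I_k -> rel (option H * option H))
         (Ph : H -> rel {set D}),
    [/\ (forall d, doctor_pref (Pd d)),
        (forall i, couple_pref (Pc i)),
        (forall h, hosp_pref (kappa h) P0 (Ph h)),
        (forall i, RVT (Pd (fdoc i)) (Pd (mdoc i)) (Pc i))
      & ~ exists mu : D -> option H, stable kappa fdoc mdoc Pd Pc Ph mu].
Proof.
move=> H2 kappa2 _ fdoc_inj mdoc_inj fm_neq D4 kappa_sum P0so P0None P0fm.
case/not_SCPI_witness => i viol.
pose f := fdoc i; pose m := mdoc i.
have nfm : f != m by apply/eqP; apply: fm_neq.
suff [h1 [h2 [d2 [Y none]]]] : exists h1 h2 d2 (Y : {set D}), forall mu,
    ~ stable kappa fdoc mdoc (tiered_Pd (tiers h1 h2 (f |: (m |: Y)) d2))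
        (tiered_Pc fdoc mdoc (tiers h1 h2 (f |: (m |: Y)) d2) i)
        (common_Ph P0) mu.
  pose t := tiers h1 h2 (f |: (m |: Y)) d2.
  have t2 d h : t d h <= 2 by apply: tiers_le2.
  exists (tiered_Pd t), (tiered_Pc fdoc mdoc t i), (common_Ph P0); split.
  - exact: tiered_doctor_pref.
  - exact: tiered_couple_pref.
  - by move=> h; apply: set_pref_hosp_pref.
  - exact: tiered_RVT.
  - by case=> mu; apply: none.
case: viol => [[m_nlow [h1 le_h1]]|[m_low btw]].
- have [e e_low] := exists_lowest_doctor m P0so.
  have me : P0 (Some m) (Some e).
    by apply: (e_low m) => eme; apply: m_nlow; rewrite -/m eme; exact: e_low.
  pose U := better_docs P0 m :\ f.
  (* S holds the partner of e when better than m; putting it into Y avoids the case where it cannot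
     gain by evicting e. *)
  pose S := [set d in U | [exists j, (d == fdoc j) && (mdoc j == e)]].
  have fB : f \in better_docs P0 m by rewrite inE P0fm.
  have cU : kappa h1 <= #|U|.+1 by move: le_h1; rewrite (cardsD1 f) fB.
  have cS : #|S| <= 1.
    apply/card_le1_eqP => x y; rewrite !inE.
    move=> /andP[_ /existsP[j /andP[/eqP -> /eqP ej]]].
    move=> /andP[_ /existsP[l /andP[/eqP -> /eqP el]]].
    by congr fdoc; apply: mdoc_inj; rewrite ej.
  have [||Y [sSY sYU cY]] := @exists_set_between D S U (kappa h1).-1.
  + by apply/subsetP => d; rewrite inE => /andP[].
  + by have := kappa2 h1; lia.
  have YU y : y \in Y -> y != f /\ P0 (Some y) (Some m).
    by move/(subsetP sYU); rewrite !inE => /andP[].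
  have fY : f \notin Y by apply/negP => /YU[]; rewrite eqxx.
  have mY : m \notin Y by apply/negP => /YU[_]; rewrite P0_irr.
  exists h1, h1, f, Y => mu mu_stable.
  apply: (not_stable_not_lowest kappa2 mdoc_inj kappa_sum P0so P0fm _ mu_stable _ fY mY
            _ _ _ me e_low) => //.
  + by move=> *; apply: tiers_le2.
  + by rewrite cY prednK // (leq_trans _ (kappa2 h1)).
  + by move=> h nh; rewrite /tiers !inE eqxx /= nh eqxx.
  + by move=> y h yY nh; rewrite /tiers !inE yY !orbT nh eqxx.
  + move=> d h dY nf nm nh; rewrite /tiers !inE (negbTE dY) (negbTE nf) (negbTE nm) /=.
    by rewrite eqxx (negbTE nh).
  + by move=> y /YU[].
  + move=> j ej fjm; apply: (subsetP sSY); rewrite !inE fjm andbT.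
    apply/andP; split; last by apply/existsP; exists j; rewrite ej !eqxx.
    apply/eqP => /fdoc_inj eji; move: me; rewrite -ej eji P0_irr //.
- have [d1 [d2 [d1B d2B nd12]]] : exists d1 d2,
      [/\ d1 \in between_docs P0 f m, d2 \in between_docs P0 f m & d1 != d2].
    by case/card_gt1P: btw => d1 [d2 []]; exists d1, d2.
  have [fd1 d1m] : P0 (Some f) (Some d1) /\ P0 (Some d1) (Some m).
    by move: d1B; rewrite inE => /andP[].
  have [fd2 d2m] : P0 (Some f) (Some d2) /\ P0 (Some d2) (Some m).
    by move: d2B; rewrite inE => /andP[].
  have neqP0 x y : P0 (Some x) (Some y) -> x != y.
    by move=> xy; apply/eqP => e; rewrite e P0_irr in xy.
  have /card_gt1P[h1 [h2 [_ _ nh12]]] : 1 < #|H| by [].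
  have nh21 : h2 != h1 by rewrite eq_sym.
  pose U := ~: [set f; m; d2].
  (* The seats of [h1] and [h2] give at least [kappa h1 + 2] doctors, so [kappa h1 - 1] remain
     outside f, m and d2. *)
  have cU : kappa h1 <= #|U|.+1.
    have := cardsC [set f; m; d2].
    have le3 : #|[set f; m; d2]| <= 3 by rewrite setUC cardsU1 cards2; lia.
    have := kappa_sum; rewrite (bigD1 h1) //= (bigD1 h2) //=.
    by have := kappa2 h2; rewrite -/U; lia.
  have [||Y [sSY sYU cY]] := @exists_set_between D [set d1] U (kappa h1).-1.
  + by rewrite sub1set !inE !negb_or nd12 (neqP0 _ _ d1m) eq_sym (neqP0 _ _ fd1).
  + by rewrite cards1; have := kappa2 h1; lia.
  have YU y : y \in Y -> [/\ y != f, y != m & y != d2].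
    by move/(subsetP sYU); rewrite !inE !negb_or => /andP[/andP[]].
  have fY : f \notin Y by apply/negP => /YU[]; rewrite eqxx.
  have mY : m \notin Y by apply/negP => /YU[_]; rewrite eqxx.
  have d2Y : d2 \notin Y by apply/negP => /YU[_ _]; rewrite eqxx.
  have d1Y : d1 \in Y by rewrite -sub1set.
  have nd2 : d2 \notin f |: (m |: Y).
    by rewrite !inE !negb_or d2Y (neqP0 _ _ d2m) eq_sym (neqP0 _ _ fd2).
  exists h1, h2, d2, Y => mu mu_stable.
  apply: (not_stable_lowest kappa2 mdoc_inj kappa_sum P0so P0fm _ mu_stable _ fY mY
            _ _ _ m_low d1Y d2Y _ fd1 fd2 nh21) => //.
  + by move=> *; apply: tiers_le2.
  + by rewrite cY prednK // (leq_trans _ (kappa2 h1)).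
  + by move=> h nh; rewrite /tiers !inE eqxx /= nh eqxx.
  + by move=> y h yY nh; rewrite /tiers !inE yY !orbT nh eqxx.
  + move=> d h dY nf nm nh; rewrite /tiers !inE (negbTE dY) (negbTE nf) (negbTE nm) /=.
    by rewrite eqxx (negbTE nh); case: ifP => _; case: eqP.
  + exact/eqP/neqP0.
  + move=> h nh; rewrite /tiers (negbTE nd2) (negbTE nh21) !eqxx nh.
    by case: ifP.
  + move=> d h dY nf nm nd nh1 nh2.
    rewrite /tiers !inE (negbTE dY) (negbTE nf) (negbTE nm) /= (negbTE nh1).
    by rewrite (negbTE nd) (negbTE nh2) (negbTE nh21) eqxx.
Qed.
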